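(* A delta-matroid has a twist of width at most one if and only if it has no minor isomorphic to a member of $\mathcal{D}_{[5]}$, where $\mathcal{D}_{[5]}$ is the set of all twists of the delta-matroids $D_1,\ldots,D_5$ defined as follows. $D_1$ is the delta-matroid on the ground set $\{a,b\}$ with feasible sets $\mathcal{F}(D_1)=\{\emptyset,\{a\},\{b\},\{a,b\}\}$, and $D_2,\ldots,D_5$ are the delta-matroids on the ground set $\{a,b,c\}$ with feasible sets $$\mathcal{F}(D_2)=\{\emptyset,\{a\},\{b\},\{c\},\{a,b,c\}\},$$ $$\mathcal{F}(D_3)=\{\emptyset,\{a,b\},\{b,c\},\{a,c\}\},$$ $$\mathcal{F}(D_4)=\{\emptyset,\{a,b\},\{b,c\},\{a,c\},\{a,b,c\}\},$$ $$\mathcal{F}(D_5)=\{\emptyset,\{a\},\{a,b\},\{b,c\},\{a,c\}\}.$$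
   Context: A delta-matroid $D=(E,\mathcal{F})$ consists of a finite set $E$ (the ground set) and a non-empty set $\mathcal{F}=\mathcal{F}(D)$ of subsets of $E$ (the feasible sets) satisfying the Symmetric Exchange Axiom: for all $X,Y\in\mathcal{F}$ and every $u\in X\triangle Y$ there is $v\in X\triangle Y$ (possibly $v=u$) with $X\triangle\{u,v\}\in\mathcal{F}$. Here $\triangle$ denotes symmetric difference. Two delta-matroids are isomorphic if there is a bijection between their ground sets carrying the feasible sets of one exactly onto the feasible sets of the other. The width of $D$ is $w(D)=\max_{F\in\mathcal{F}}|F|-\min_{F\in\mathcal{F}}|F|$. For $A\subseteq E$, the twist of $D$ with respect to $A$ is the delta-matroid $D*A=(E,\{A\triangle F: F\in\mathcal{F}\})$. A twist of $D$ is any $D*A$ with $A\subseteq E$ (including the empty twist $D*\emptyset=D$). Minors: an element $e$ is a coloop of $D$ if it is in every feasible set and a loop if it is in no feasible set. If $e$ is not a coloop, $D\setminus e=(E-e,\{F: F\in\mathcal{F}, F\subseteq E-e\})$. If $e$ is not a loop, $D/e=(E-e,\{F-e: F\in\mathcal{F}, e\in F\})$. If $e$ is a loop or coloop, then $D/e=D\setminus e$. The result of a sequence of deletions and contractions does not depend on the order. A minor of $D$ is any delta-matroid obtained from $D$ by a (possibly empty) sequence of deletions $D\mapsto D\setminus e$ and contractions $D\mapsto D/e$. *)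

(* Defs.v *)
From mathcomp Require Import all_boot.

Set Implicit Arguments.
Unset Strict Implicit.
Unset Printing Implicit Defensive.

(* The ground set is a subset of an ambient finite type, so that deletion and
   contraction do not change the type. *)
Record set_system (T : finType) : Type := SetSystem {
  ground : {set T};
  feasible : {set {set T}}
}.

Definition symdiff (T : finType) (X Y : {set T}) : {set T} :=
  (X :\: Y) :|: (Y :\: X).

Notation "X :+: Y" := (symdiff X Y) (at level 52, left associativity).

Definition is_delta_matroid (T : finType) (D : set_system T) : Prop :=
  [/\ forall F, F \in feasible D -> F \subset ground D,
      feasible D != set0
    & forall X Y : {set T}, X \in feasible D -> Y \in feasible D ->
      forall u, u \in X :+: Y ->
      exists2 v, v \in X :+: Y & X :+: [set u; v] \in feasible D].

(* The default value #|ground D| of the minimum is harmless: it bounds the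
   size of every feasible set, and there is at least one of them. *)
Definition width (T : finType) (D : set_system T) : nat :=
  \max_(F in feasible D) #|F|
  - \big[minn/#|ground D|]_(F in feasible D) #|F|.

(* Only meaningful when A \subset ground D. *)
Definition twist (T : finType) (D : set_system T) (A : {set T}) :
    set_system T :=
  SetSystem (ground D) [set A :+: F | F in feasible D].

Definition coloop (T : finType) (D : set_system T) (e : T) : bool :=
  [forall F in feasible D, e \in F].

Definition loop (T : finType) (D : set_system T) (e : T) : bool :=
  [forall F in feasible D, e \notin F].

Definition avoiding (T : finType) (D : set_system T) (e : T) : set_system T :=
  SetSystem (ground D :\ e)
    [set F in feasible D | F \subset ground D :\ e].

Definition containing (T : finType) (D : set_system T) (e : T) :
    set_system T :=
  SetSystem (ground D :\ e) [set F :\ e | F in feasible D & e \in F].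

(* For a loop or a coloop, deletion and contraction agree, and are computed by
   whichever of the two formulas applies. *)
Definition deletion (T : finType) (D : set_system T) (e : T) : set_system T :=
  if coloop D e then containing D e else avoiding D e.

Definition contraction (T : finType) (D : set_system T) (e : T) :
    set_system T :=
  if loop D e then avoiding D e else containing D e.

Inductive minor (T : finType) (D : set_system T) : set_system T -> Prop :=
| minor_refl : minor D D
| minor_deletion M e :
    minor D M -> e \in ground M -> minor D (deletion M e)
| minor_contraction M e :
    minor D M -> e \in ground M -> minor D (contraction M e).

(* The bijection is between the ground sets, not the ambient types; since the
   feasible sets lie in the ground set, it is enough to look at the sets X of
   elements of the ground set. *)
Definition isomorphic (T1 T2 : finType)
    (D1 : set_system T1) (D2 : set_system T2) : Prop :=
  exists2 f : {x | x \in ground D1} -> {y | y \in ground D2},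
    bijective f &
    forall X : {set {x | x \in ground D1}},
      (val @: X \in feasible D1) = (val @: (f @: X) \in feasible D2).

Definition a : 'I_3 := @Ordinal 3 0 isT.
Definition b : 'I_3 := @Ordinal 3 1 isT.
Definition c : 'I_3 := @Ordinal 3 2 isT.

Definition D1 : set_system 'I_3 :=
  SetSystem [set a; b] [set set0; [set a]; [set b]; [set a; b]].

Definition D2 : set_system 'I_3 :=
  SetSystem [set a; b; c] [set set0; [set a]; [set b]; [set c]; [set a; b; c]].

Definition D3 : set_system 'I_3 :=
  SetSystem [set a; b; c] [set set0; [set a; b]; [set b; c]; [set a; c]].

Definition D4 : set_system 'I_3 :=
  SetSystem [set a; b; c]
    [set set0; [set a; b]; [set b; c]; [set a; c]; [set a; b; c]].

Definition D5 : set_system 'I_3 :=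
  SetSystem [set a; b; c]
    [set set0; [set a]; [set a; b]; [set b; c]; [set a; c]].

Definition excluded_minor (N : set_system 'I_3) : Prop :=
  exists (D : set_system 'I_3) (A : {set 'I_3}),
    [/\ D = D1 \/ D = D2 \/ D = D3 \/ D = D4 \/ D = D5,
        A \subset ground D
      & N = twist D A].

Lemma in_symdiff (T : finType) (X Y : {set T}) x :
  (x \in X :+: Y) = (x \in X) (+) (x \in Y).
Proof. by rewrite !inE; case: (x \in X); case: (x \in Y). Qed.

Lemma symdiffA (T : finType) : associative (@symdiff T).
Proof. by move=> X Y Z; apply/setP=> x; rewrite !in_symdiff addbA. Qed.

Lemma symdiff_twist (T : finType) (A X Y : {set T}) :
  (A :+: X) :+: (A :+: Y) = X :+: Y.
Proof. by apply/setP=> x; rewrite !in_symdiff addbACA addbb. Qed.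

Lemma twist_delta_matroid (T : finType) (D : set_system T) (A : {set T}) :
  A \subset ground D -> is_delta_matroid D -> is_delta_matroid (twist D A).
Proof.
move=> sA [sF F0 ex]; split=> /=.
- move=> _ /imsetP[F FD ->]; apply/subsetP=> x.
  rewrite !inE => /orP[] /andP[_]; first exact: (subsetP sA).
  exact: (subsetP (sF _ FD)).
- have /set0Pn[F FD] := F0; apply/set0Pn; exists (A :+: F); exact: imset_f.
- move=> _ _ /imsetP[X XD ->] /imsetP[Y YD ->] u; rewrite symdiff_twist => uXY.
  have [v vXY FD] := ex X Y XD YD u uXY.
  by exists v; rewrite // -symdiffA imset_f.
Qed.

Lemma avoiding_delta_matroid (T : finType) (D : set_system T) e :
  ~~ coloop D e -> is_delta_matroid D -> is_delta_matroid (avoiding D e).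
Proof.
move=> ncl [sF F0 ex]; split=> /=.
- by move=> F; rewrite inE => /andP[].
- move: ncl; rewrite negb_forall_in => /exists_inP[F FD eF].
  by apply/set0Pn; exists F; rewrite inE FD subsetD1 sF.
- move=> X Y; rewrite !inE => /andP[XD sX] /andP[YD sY] u uXY.
  have [v vXY FD] := ex X Y XD YD u uXY; exists v => //.
  have sXY w : w \in X :+: Y -> w \in ground D :\ e.
    rewrite in_setU => /orP[] /setDP[]; first by move/(subsetP sX).
    by move/(subsetP sY).
  rewrite inE FD; apply/subsetP=> x; rewrite in_setU.
  case/orP=> /setDP[]; first by move/(subsetP sX).
  by case/set2P=> ->; rewrite sXY.
Qed.

Lemma containing_delta_matroid (T : finType) (D : set_system T) e :
  ~~ loop D e -> is_delta_matroid D -> is_delta_matroid (containing D e).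
Proof.
move=> nl [sF F0 ex]; split=> /=.
- by move=> _ /imsetP[F /setIdP[FD _] ->]; apply: setSD; apply: sF.
- move: nl; rewrite negb_forall_in => /exists_inP[F FD /negPn eF].
  by apply/set0Pn; exists (F :\ e); apply: imset_f; rewrite inE FD.
- move=> _ _ /imsetP[X /setIdP[XD eX] ->] /imsetP[Y /setIdP[YD eY] ->] u.
  have -> : (X :\ e) :+: (Y :\ e) = X :+: Y.
    apply/setP=> x; rewrite !in_symdiff !in_setD1.
    by case: eqP => // ->; rewrite eX eY.
  move=> uXY; have [v vXY FD] := ex X Y XD YD u uXY; exists v => //.
  have neq w : w \in X :+: Y -> e == w = false.
    by apply: contraTF => /eqP<-; rewrite in_symdiff eX eY.
  have eF : e \in X :+: [set u; v].
    by rewrite in_symdiff eX in_set2 !neq.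
  have -> : X :\ e :+: [set u; v] = (X :+: [set u; v]) :\ e.
    apply/setP=> x; rewrite in_setD1 !in_symdiff in_setD1.
    by case: eqP => //= ->; rewrite in_set2 !neq.
  by apply: imset_f; rewrite inE FD.
Qed.

Lemma loop_coloop (T : finType) (D : set_system T) e :
  is_delta_matroid D -> ~~ (loop D e && coloop D e).
Proof.
case=> _ /set0Pn[F FD] _; apply/negP=> /andP[/forall_inP/(_ F FD)].
by move=> /negP neF /forall_inP/(_ F FD).
Qed.

Lemma minor_delta_matroid (T : finType) (D M : set_system T) :
  is_delta_matroid D -> minor D M -> is_delta_matroid M.
Proof.
move=> DD; elim=> // {}M e _ MD _; have := loop_coloop e MD.
  rewrite /deletion; case: ifPn => [_|ncl _]; last exact: avoiding_delta_matroid.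
  by rewrite andbT => nl; apply: containing_delta_matroid.
rewrite /contraction; case: ifPn => [_ ncl|nl _].
  exact: avoiding_delta_matroid.
exact: containing_delta_matroid.
Qed.

(* Main.v *)
Require Import Defs.
From mathcomp Require Import all_boot zify.

(* For a feasible X, let H_X be the graph on the ground set plus one extra
   vertex, with an edge xy when X + {x, y} is feasible and an edge from x to the
   extra vertex when X + {x} is feasible (+ is symmetric difference).  If D has a
   twist of width at most one then H_X is 2-colourable: colour x by membership in
   A + X.  Conversely, the exchange axiom shows that a 2-colouring of a single H_X
   yields such a twist, the only obstruction being a triple of loops as in D2.

   So in a minimal counterexample every H_X has an odd cycle, and every odd cycle
   of every H_X passes through all elements; hence a shortest one is an induced
   odd cycle through the whole ground set.  If it has length 3, then one of
   D1, D3, D4, D5 appears.  Otherwise it contains an induced path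
   p0 p1 p2 p3 whose ends are not loops, except when it consists of the extra
   vertex and four elements.  Passing from X to X + {p1, p2} (or, in the
   exceptional case, to X + {p0} and X + {p3}) gives a graph H that cannot have an
   odd cycle of this kind. *)

Set Implicit Arguments.
Unset Strict Implicit.
Unset Printing Implicit Defensive.

(** * Shortest odd cycles *)

(** Every edge of the double cover [e2] changes sheet. A path joining the two points over one vertex
    projects to an odd closed walk; if there is none, the parity of walks from a chosen root is a
    colouring. *)
Lemma odd_cycle_or_coloring (V : finType) (e : rel V) : symmetric e ->
  (exists2 s : seq V, cycle e s & odd (size s)) \/
  (exists c : V -> bool, forall x y, e x y -> c x != c y).
Proof.
move=> e_sym.
pose e2 := [rel u v : V * bool | e u.1 v.1 && (u.2 != v.2)].
have e2_sym : symmetric e2 by move=> u v; rewrite /= e_sym eq_sym.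
have c_sym := sym_connect_sym e_sym; have c2_sym := sym_connect_sym e2_sym.
have parity p u : path e2 u p -> (last u p).2 = u.2 (+) odd (size p).
  elim: p u => [|v p IHp] u /=; first by rewrite addbF.
  by case/andP=> /andP[_ uv] /IHp->; move: uv; case: u.2; case: v.2; case: odd.
have proj p u : path e2 u p -> path e u.1 [seq v.1 | v <- p].
  elim: p u => //= v p IHp u /andP[/andP[euv _] /IHp pvp].
  by rewrite euv pvp.
case: (pickP (fun y => connect e2 (y, true) (y, false))) => [y /connectP[p yp lastp]|noW].
  left; exists [seq v.1 | v <- p].
    by rewrite (cycle_path y) -[y in last y _]/(y, true).1 last_map -lastp (proj _ _ yp).
  by rewrite size_map; have := parity _ _ yp; rewrite -lastp /=; case: odd.
right; exists (fun x => connect e2 (root e x, false) (x, true)) => x y exy.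
have -> : root e x = root e y by apply/rootP=> //; apply: connect1.
set r := root e y.
have e2xy b : connect e2 (x, b) (y, ~~ b) by apply: connect1; rewrite /= exy; case: b.
(* If both colours are true, an odd walk from [r] to [x], the edge to [y] and an odd walk from [r]
   to [y] join the two points over [y]. If both are false, a walk from [r] to [y] must be even, and
   the edge extends it to an odd walk to [x]. *)
apply/eqP; case cx: (connect e2 (r, false) (x, true)) => cy.
  have yf := connect_trans cx (e2xy true).
  by have := noW y; rewrite c2_sym in cy; rewrite /= (connect_trans _ yf) // c2_sym -cy c2_sym.
have : connect e r y by rewrite c_sym connect_root.
have lift p b u : path e u p -> exists b', connect e2 (u, b) (last u p, b').
  elim: p b u => [|v p IHp] b u /=; first by exists b.
  case/andP=> euv /(IHp (~~ b))[b' cvb']; exists b'.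
  by apply: connect_trans cvb'; apply: connect1; rewrite /= euv; case: (b).
case/connectP=> p /(lift _ false)[b' cb'] lastp; rewrite -lastp in cb'.
case: b' cb'; first by rewrite -cy.
move=> cyf; have eyx : connect e2 (y, false) (x, true) by apply: connect1; rewrite /= e_sym exy.
by rewrite (connect_trans cyf eyx) in cx.
Qed.

(** Colours alternate along the walk, so it closes up only after an even number of steps. Properness
    is asked on [s] alone because later the colouring comes from a restriction to the elements of
    [s]. *)
Lemma cycle_even (V : eqType) (e : rel V) (c : V -> bool) (s : seq V) :
  {in s &, forall x y, e x y -> c x != c y} -> cycle e s -> ~~ odd (size s).
Proof.
case: s => // x p cP.
have aux q y : {subset y :: q <= x :: p} -> path e y q ->
    c (last y q) = c y (+) odd (size q).
  elim: q y => [|z q IHq] y /= sub; first by rewrite addbF.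
  case/andP=> eyz zq; rewrite (IHq z) => [|t tq|//]; last first.
    by apply: sub; rewrite inE tq orbT.
  have := cP y z (sub _ (mem_head _ _)) _ eyz.
  rewrite sub ?inE ?eqxx ?orbT // => /(_ isT).
  by case: (c y); case: (c z); case: odd.
have sub : {subset x :: rcons p x <= x :: p}.
  by move=> t; rewrite inE mem_rcons => /predU1P[->|//]; apply: mem_head.
by move/(aux _ _ sub); rewrite last_rcons size_rcons /=; case: (c x); case: odd.
Qed.

(** [cycle] describes closed walks; that a shortest odd one repeats no vertex is proved below. *)
Definition min_odd_cycle (V : eqType) (e : rel V) (s : seq V) :=
  [/\ cycle e s, odd (size s)
    & forall s', cycle e s' -> odd (size s') -> size s <= size s'].

Lemma exists_min_odd_cycle (V : finType) (e : rel V) (s : seq V) :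
  cycle e s -> odd (size s) -> exists s', min_odd_cycle e s'.
Proof.
move=> cs os.
pose P n := odd n && [exists t : n.-tuple V, cycle e t].
have exP : exists n, P n.
  by exists (size s); rewrite /P os; apply/existsP; exists (in_tuple s).
case: (ex_minnP exP) => n /andP[on /existsP[t ct]] nmin.
exists t; split; rewrite ?size_tuple // => s' cs' os'.
by apply: nmin; rewrite /P os'; apply/existsP; exists (in_tuple s').
Qed.

Lemma min_odd_cycle_rot (V : eqType) (e : rel V) n (s : seq V) :
  min_odd_cycle e s -> min_odd_cycle e (rot n s).
Proof. by case=> cs os smin; split; rewrite ?rot_cycle ?size_rot. Qed.

(** A repeated vertex splits the walk into two shorter closed walks, one of which is odd. *)
Lemma min_odd_cycle_uniq (V : eqType) (e : rel V) (s : seq V) :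
  min_odd_cycle e s -> uniq s.
Proof.
move=> ms; apply/idP/negPn/negP=> nu.
have [p0 [x [p1 [p2 Es]]]] : exists p0 x p1 p2, s = p0 ++ x :: p1 ++ x :: p2.
  elim: s nu {ms} => //= x s IHs; rewrite negb_and negbK.
  case xs: (x \in s) => /=.
    by move=> _; case/splitPr: xs => p1 p2; exists [::], x, p1, p2.
  by case/IHs=> p0 [y [p1 [p2 ->]]]; exists (x :: p0), y, p1, p2.
have := min_odd_cycle_rot (size p0) ms; rewrite Es rot_size_cat /= -catA /=.
move: (p2 ++ p0) => {ms nu Es p0 s}p2 [cs os smin].
move: cs; rewrite /= rcons_cat cat_path /= => /and3P[p1P eP p2P].
have c1 : cycle e (x :: p1) by rewrite /= rcons_path p1P.
have c2 : cycle e (x :: p2) by [].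
move: (smin _ c1) (smin _ c2) os; rewrite /= !size_cat /=; lia.
Qed.

(** The chord cuts the cycle into two, with lengths adding up to that of the cycle plus two. One of
    them is odd, and by minimality the arc it omits is empty. *)
Lemma min_odd_cycle_chord (V : eqType) (e : rel V) x p1 y p2 :
  symmetric e -> min_odd_cycle e (x :: p1 ++ y :: p2) -> e x y ->
  p1 = [::] \/ p2 = [::].
Proof.
move=> e_sym [cs os smin] exy.
move: cs; rewrite /= rcons_cat cat_path /= => /and3P[p1P eP p2P].
have c1 : cycle e (x :: rcons p1 y) by rewrite /= !rcons_path p1P eP last_rcons e_sym.
have c2 : cycle e [:: x, y & p2] by rewrite /= exy.
move: (smin _ c1) (smin _ c2) os; rewrite /= !size_cat !size_rcons /=.
case: p1 {p1P eP smin c1} => [|? ?]; first by left.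
by case: p2 {p2P c2} => [|? ?]; [right|rewrite /=; lia].
Qed.

(** * Positions along a shortest odd cycle *)

Definition cyclic_succ n i := if i.+1 == n then 0 else i.+1.

Definition cyclic_neighbors n i j := (j == cyclic_succ n i) || (i == cyclic_succ n j).

Lemma cyclic_succ_inj n i j : cyclic_succ n i = cyclic_succ n j -> i = j.
Proof. rewrite /cyclic_succ; case: eqP; case: eqP; lia. Qed.

(** A walk on a cycle that never turns back keeps its direction, so closing after four steps would
    force [n] to divide 4. An odd [n] leaves only [n = 1], which [i != k] excludes. *)
Lemma cyclic_neighbors_quadrangle n i j k l : odd n -> i < n -> i != k -> j != l ->
  cyclic_neighbors n i j -> cyclic_neighbors n j k -> cyclic_neighbors n k l ->
  ~~ cyclic_neighbors n l i.
Proof.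
(* Exchanging [j] and [l] reverses the direction of the walk. *)
wlog: j l / j == cyclic_succ n i.
  move=> IH on ltin ik jl ij jk kl; apply/negP=> li.
  have cnC i' j' : cyclic_neighbors n i' j' = cyclic_neighbors n j' i' by apply: orbC.
  case/orP: (ij) => [ji|/eqP iSj]; first by case/negP: (IH j l ji on ltin ik jl ij jk kl).
  have lSi : l == cyclic_succ n i.
    by case/orP: li => [/eqP iSl|//]; rewrite iSl in iSj; rewrite (cyclic_succ_inj iSj) eqxx in jl.
  rewrite eq_sym in jl; rewrite cnC in li; rewrite cnC in kl; rewrite cnC in jk.
  by have := IH l j lSi on ltin ik jl li kl jk; rewrite cnC ij.
move=> /eqP -> on ltin ik il _ /orP[/eqP Ek|/eqP/cyclic_succ_inj Ek]; last by rewrite Ek eqxx in ik.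
rewrite Ek => /orP[/eqP El|/eqP/cyclic_succ_inj El]; last by rewrite El eqxx in il.
rewrite El; apply/norP; split; apply/eqP; last first.
  by move/cyclic_succ_inj=> Ei; rewrite Ek Ei eqxx in ik.
by rewrite Ek in ik; move: ik; rewrite /cyclic_succ; repeat case: eqP; lia.
Qed.

(** Once the cycle is rotated to start at [x], [min_odd_cycle_chord] leaves [y] only the second or
    the last place. *)
Lemma min_odd_cycle_adj (V : eqType) (e : rel V) (s : seq V) x y :
  symmetric e -> irreflexive e -> min_odd_cycle e s ->
  x \in s -> y \in s -> e x y -> cyclic_neighbors (size s) (index x s) (index y s).
Proof.
move=> e_sym e_irr ms.
wlog lt_ij : x y / index x s < index y s.
  move=> IH xs ys exy; case: (ltngtP (index x s) (index y s)) => [lt|lt|eq].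
  - exact: IH.
  - have := IH _ _ lt ys xs; rewrite e_sym => /(_ exy); rewrite /cyclic_neighbors /cyclic_succ; lia.
  - by move: exy; rewrite -(nth_index x xs) eq nth_index // e_irr.
move=> xs ys exy; have us := min_odd_cycle_uniq ms.
case/splitPr: xs ms us ys lt_ij exy => p1 p2 ms us ys lt_ij exy.
have xp1 : x \notin p1 by move: us; rewrite cat_uniq /= => /and3P[_ /norP[]].
have ix : index x (p1 ++ x :: p2) = size p1.
  by rewrite index_cat (negPf xp1) /= eqxx addn0.
have yp2 : y \in p2.
  move: lt_ij; rewrite ix index_cat; case: ifP => [|yp1 _].
    by rewrite -index_mem; lia.
  by move: ys; rewrite mem_cat inE yp1 => /predU1P[yx|//]; rewrite yx e_irr in exy.
move: ms us ix lt_ij ys; case/splitPr: yp2 => q1 q2 ms us ix lt_ij ys.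
have iy : index y (p1 ++ x :: q1 ++ y :: q2) = size p1 + (size q1).+1.
  move: us; rewrite -[_ :: q1 ++ _]cat_cons catA cat_uniq => /and3P[_ /norP[yn _] _].
  by rewrite index_cat (negPf yn) /= eqxx addn0 size_cat.
have := min_odd_cycle_rot (size p1) ms.
rewrite rot_size_cat /= -catA /= => /(min_odd_cycle_chord e_sym)/(_ exy).
rewrite /cyclic_neighbors ix iy !size_cat /= size_cat /=.
case=> [->|]; first by rewrite /cyclic_succ /=; do 2!case: ifP; lia.
case: q2 {ms us ix lt_ij ys iy} => //= /eqP; rewrite -size_eq0 => /eqP ->.
by rewrite /cyclic_succ; do 2!case: ifP; lia.
Qed.

Lemma min_odd_cycle_nth (V : eqType) (e : rel V) (s : seq V) x0 i j :
  symmetric e -> irreflexive e -> min_odd_cycle e s -> i < size s -> j < size s ->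
  e (nth x0 s i) (nth x0 s j) -> cyclic_neighbors (size s) i j.
Proof.
move=> e_sym e_irr ms lti ltj /(min_odd_cycle_adj e_sym e_irr ms).
by rewrite !mem_nth // !index_uniq ?(min_odd_cycle_uniq ms) //; apply.
Qed.

Lemma min_odd_cycle_quadrangle (V : eqType) (e : rel V) (s : seq V) w x y z :
  symmetric e -> irreflexive e -> min_odd_cycle e s -> {subset [:: w; x; y; z] <= s} ->
  uniq [:: w; x; y; z] -> e w x -> e x y -> e y z -> ~~ e z w.
Proof.
move=> e_sym e_irr ms sub un ewx exy eyz; apply/negP=> ezw.
have [ws xs ys zs] : [/\ w \in s, x \in s, y \in s & z \in s].
  by split; apply: sub; rewrite !inE eqxx ?orbT.
have neq u v : u \in s -> u != v -> index u s != index v s.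
  move=> us; apply: contraNN => /eqP iuv; have vs : v \in s by rewrite -index_mem -iuv index_mem.
  by rewrite -(nth_index u us) iuv nth_index.
have adjs := min_odd_cycle_adj e_sym e_irr ms.
have [_ os _] := ms; move: un; rewrite /= !inE !negb_or -!andbA.
case/and5P=> _ wy _ _ /and3P[xz _ _]; move: (adjs _ _ zs ws ezw); apply/negP.
apply: cyclic_neighbors_quadrangle os _ (neq _ _ ws wy) (neq _ _ xs xz)
  (adjs _ _ ws xs ewx) (adjs _ _ xs ys exy) (adjs _ _ ys zs eyz).
by rewrite index_mem.
Qed.

(** The witnesses are the two neighbours of [x] along the cycle, distinct because its length is at
    least three. *)
Lemma min_odd_cycle_degree (V : eqType) (e : rel V) (s : seq V) x :
  symmetric e -> irreflexive e -> min_odd_cycle e s -> x \in s ->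
  exists u v, [/\ u != v, e x u & e x v].
Proof.
move=> e_sym e_irr ms xs; have [n s' Es'] := rot_to xs.
have := min_odd_cycle_rot n ms; rewrite Es' => {}ms.
have := min_odd_cycle_uniq ms; have [cs os _] := ms.
case: s' cs os {ms Es'} => [|u [|y p]] //=; first by rewrite e_irr.
rewrite rcons_path => /and3P[xu _ /andP[_ lx]] _ /and3P[_ /norP[uy up] _].
exists u, (last y p); split=> //; last by rewrite e_sym.
by apply/eqP=> Eu; have := mem_last y p; rewrite -Eu inE (negPf uy); apply/negP.
Qed.

(** * Fundamental graphs and width *)

(** Testing membership of one point turns an identity of symmetric differences into a Boolean one,
    decided by cases. *)
Ltac symdiff_tac :=
  apply/setP=> ?; rewrite ?(in_symdiff, in_set0);
  repeat match goal with |- context [?x \in ?A] => case: (x \in A) end; done.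

Section SymmetricDifference.
Variable T : finType.
Implicit Types (X Y Z W : {set T}) (x y : T).

Lemma symdiff0 X : X :+: set0 = X. Proof. symdiff_tac. Qed.

Lemma symdiff0l X : set0 :+: X = X. Proof. symdiff_tac. Qed.

Lemma symdiffK X Y : X :+: (X :+: Y) = Y. Proof. symdiff_tac. Qed.

Lemma symdiffAC X Y Z : X :+: Y :+: Z = X :+: Z :+: Y. Proof. symdiff_tac. Qed.

Lemma symdiff_set2 x y : x != y -> [set x; y] = [set x] :+: [set y].
Proof.
by move=> xy; apply/setP=> z; rewrite in_symdiff !inE; case: eqP => [->|]; rewrite ?(negPf xy).
Qed.

(** Doubling the membership bit covers both adding and removing [x] without truncated
    subtraction. *)
Lemma card_symdiff1 W x : #|W :+: [set x]| + (x \in W).*2 = #|W|.+1.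
Proof.
case xW: (x \in W).
  have -> : W :+: [set x] = W :\ x.
    by apply/setP=> z; rewrite in_symdiff !inE; case: eqP => [->|]; rewrite ?xW ?addbF.
  by rewrite [#|W|](cardsD1 x) xW /=; lia.
have -> : W :+: [set x] = x |: W.
  by apply/setP=> z; rewrite in_symdiff !inE; case: eqP => [->|]; rewrite ?xW ?addbF.
by rewrite cardsU1 xW /=; lia.
Qed.

Lemma card_symdiff_split (A B : {set T}) : #|A :+: B| = #|A :\: B| + #|B :\: A|.
Proof.
rewrite /symdiff cardsU; suff -> : (A :\: B) :&: (B :\: A) = set0 by rewrite cards0 subn0.
by apply/setP=> z; rewrite !inE; case: (z \in A); case: (z \in B).
Qed.

End SymmetricDifference.

Lemma in_twist (T : finType) (M : set_system T) (X F : {set T}) :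
  (F \in feasible (twist M X)) = (X :+: F \in feasible M).
Proof.
apply/imsetP/idP => [[G GM ->]|XF]; first by rewrite symdiffK.
by exists (X :+: F); rewrite ?symdiffK.
Qed.

Section DeltaMatroids.
Variable T : finType.
Implicit Types (M : set_system T) (X Y F G S : {set T}) (u v : option T).

Lemma set_system_eq M N : ground M = ground N -> feasible M = feasible N -> M = N.
Proof. by case: M => ? ?; case: N => ? ? /= -> ->. Qed.

Lemma exchange M F G x : is_delta_matroid M -> F \in feasible M -> G \in feasible M ->
  x \in F :+: G -> F :+: [set x] \in feasible M \/
  exists y, [/\ y \in F :+: G, y != x & F :+: [set x] :+: [set y] \in feasible M].
Proof.
move=> [_ _ ex] FM GM xFG; have [y yFG] := ex F G FM GM x xFG.
have [->|yx] := eqVneq y x; first by rewrite setUid; left.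
by rewrite symdiff_set2 1?eq_sym // symdiffA; right; exists y.
Qed.

Definition singleton_of u : {set T} := if u is Some x then [set x] else set0.

(* The fundamental graph at X, with a vertex None joined to the x such that
   X + x is feasible: such a loop at x becomes an ordinary edge. *)
Definition adj M X : rel (option T) := fun u v =>
  (u != v) && (X :+: singleton_of u :+: singleton_of v \in feasible M).

Lemma adj_sym M X : symmetric (adj M X).
Proof. by move=> u v; rewrite /adj eq_sym symdiffAC. Qed.

Lemma adj_irr M X : irreflexive (adj M X).
Proof. by move=> u; rewrite /adj eqxx. Qed.

Lemma adj_edge M X x y :
  adj M X (Some x) (Some y) = (x != y) && (X :+: [set x] :+: [set y] \in feasible M).
Proof. by []. Qed.

Lemma adj_loop M X x : adj M X (Some x) None = (X :+: [set x] \in feasible M).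
Proof. by rewrite /adj /= symdiff0. Qed.

Lemma adj_twist M X : adj (twist M X) set0 =2 adj M X.
Proof.
by move=> u v; rewrite /adj in_twist symdiff0l symdiffA.
Qed.

(** Since [x] differs from [v], it lies in exactly one of the two feasible sets that the edge
    joins. *)
Lemma adj_ground M X x v : is_delta_matroid M -> X \in feasible M ->
  adj M X (Some x) v -> x \in ground M.
Proof.
move=> [sM _ _] XM /andP[xv /sM/subsetP/(_ x)].
rewrite !in_symdiff /= set11 addbT.
have -> : x \in singleton_of v = false.
  by case: v xv => [y|]; rewrite /= inE // eq_sym => /negPf; apply: contraFF => /eqP->.
rewrite addbF; case xX: (x \in X) => /=; last by apply.
by move=> _; exact: (subsetP (sM _ XM) _ xX).
Qed.

(** * Width at most one and 2-colourings *)

(** The twist by [A] has width at most one. [A] ranges over all sets of the ambient type, which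
    makes invariance under twists immediate. *)
Definition thin M := exists A k, forall F, F \in feasible M -> k <= #|A :+: F| <= k.+1.

Lemma width_le1 M : is_delta_matroid M ->
  (width M <= 1) <-> exists k, forall F, F \in feasible M -> k <= #|F| <= k.+1.
Proof.
move=> [sM /set0Pn[F0 F0M] _]; rewrite /width; split.
  set m := \big[minn/_]_(F in _) _ => le1; exists m => F FM; apply/andP; split.
    rewrite /m -big_filter; have : F \in [seq G <- index_enum {set T} | G \in feasible M].
      by rewrite mem_filter FM mem_index_enum.
    elim: (filter _ _) => // G s IHs; rewrite inE big_cons geq_min.
    by case/predU1P=> [->|/IHs->]; rewrite ?leqnn ?orbT.
  by apply: leq_trans (_ : \max_(F in feasible M) #|F| <= _); [apply: leq_bigmax_cond|lia].
case=> k kP; set m := \big[minn/_]_(F in _) _.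
have : \max_(F in feasible M) #|F| <= k.+1 by apply/bigmax_leqP=> F /kP/andP[].
have : k <= m.
  apply: (big_ind (fun n => k <= n)) => [||F /kP/andP[] //].
    (* The default value of the minimum must be at least [k] too; it bounds the size of the feasible
       [F0]. *)
    by have /andP[kF0 _] := kP _ F0M; apply: leq_trans kF0 _; apply/subset_leq_card/sM.
  by move=> *; rewrite leq_min; apply/andP.
lia.
Qed.

Lemma thin_width M : is_delta_matroid M ->
  thin M <-> exists2 A : {set T}, A \subset ground M & width (twist M A) <= 1.
Proof.
move=> dM; split=> [[A [k kP]]|[A sA]].
  exists (A :&: ground M); first exact: subsetIr.
  apply/width_le1; first by apply: twist_delta_matroid => //; apply: subsetIr.
  (* The elements of [A] outside the ground set lie in every [A :+: G] with [G] feasible, so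
     discarding them lowers all sizes equally. *)
  exists (k - #|A :\: ground M|) => F; rewrite in_twist => FM.
  have [G sG [GM EF]] : exists2 G : {set T}, G \subset ground M &
      G \in feasible M /\ F = A :&: ground M :+: G.
    by exists (A :&: ground M :+: F); rewrite ?symdiffK //; case: dM => sM _ _; apply: sM.
  have kG := kP _ GM.
  have : #|A :+: G| = #|A :\: ground M| + #|F|.
    rewrite EF -cardsUI.
  rewrite [X in _ = _ + X](_ : _ = 0) ?addn0; last first.
      apply/eqP; rewrite cards_eq0; apply/eqP/setP=> z.
      rewrite !(in_setI, in_setD, in_symdiff, in_set0); have := subsetP sG z.
      by case: (z \in G) => [/(_ isT)->|_]; case: (z \in A); case: (z \in ground M).
    apply: eq_card => z; rewrite !(in_setU, in_symdiff, in_setI, in_setD).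
    have := subsetP sG z.
    by case: (z \in G) => [/(_ isT)->|_]; case: (z \in A); case: (z \in ground M).
  by move: kG; lia.
move/width_le1 => -[|k kP]; first exact: twist_delta_matroid.
by exists A, k => F FM; apply: kP; rewrite in_twist symdiffK.
Qed.

Lemma thin_twist M X : thin (twist M X) -> thin M.
Proof.
case=> A [k kP]; exists (A :+: X), k => F FM; rewrite -symdiffA.
by apply: kP; rewrite in_twist symdiffK.
Qed.

(** An edge toggles two elements of [W] and its size stays in {k, k+1}, so one of them enters and
    the other leaves. *)
Lemma thin_coloring M X : thin M -> X \in feasible M ->
  exists c : option T -> bool, forall u v, adj M X u v -> c u != c v.
Proof.
case=> A [k kP] XM; pose W := A :+: X.
have kW : k <= #|W| <= k.+1 by apply: kP.
(* If [W] has size [k], a loop must enlarge it and so lies outside [W]; [None] is then coloured like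
   a member of [W]. In the other case the roles are exchanged. *)
exists (fun u => if u is Some x then x \in W else #|W| == k) => u v.
rewrite /adj => /andP[uv /kP]; rewrite !symdiffA -/W.
case: u uv => [x|] uv; case: v uv => [y|] //= uv; rewrite ?symdiff0.
- have := card_symdiff1 W x; have := card_symdiff1 (W :+: [set x]) y.
  have -> : (y \in W :+: [set x]) = (y \in W).
    have /negPf yx : y != x by apply: contraNN uv => /eqP->.
    by rewrite in_symdiff inE yx addbF.
  by move: kW; case: (x \in W); case: (y \in W); rewrite /=; lia.
- by have := card_symdiff1 W x; move: kW; case: (x \in W); case: eqP; rewrite /=; lia.
- by have := card_symdiff1 W y; move: kW; case: (y \in W); case: eqP; rewrite /=; lia.
Qed.

(* When the empty set is feasible and B is the colour class of None, every
   feasible G is balanced: [#|G :&: B| <= #|G :\: B| <= #|G :&: B|.+1].  An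
   exchange of G with the empty set shrinks G and preserves a violation, until
   G lies in one colour class, where only the triple of D2 can violate. *)
Lemma coloring_thin0 M (c : option T -> bool) : is_delta_matroid M ->
  set0 \in feasible M -> (forall u v, adj M set0 u v -> c u != c v) ->
  (forall p q r, uniq [:: p; q; r] -> [set p] \in feasible M ->
     [set q] \in feasible M -> [set r] \in feasible M ->
     [set p] :+: [set q] :+: [set r] \notin feasible M) ->
  thin M.
Proof.
move=> dM M0 cP noD2; pose B := [set x | c (Some x) == c None].
have loopN x : [set x] \in feasible M -> x \notin B.
  move=> xM; rewrite inE; apply: cP; apply/andP; split=> //=.
  by rewrite symdiff0 symdiff0l.
have edgeN x y : x != y -> [set x] :+: [set y] \in feasible M -> (x \in B) != (y \in B).
  move=> xy xyM; rewrite !inE.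
  have := cP (Some x) (Some y); rewrite /adj /= symdiff0l xyM andbT.
  by move/(_ xy); case: (c (Some x)); case: (c (Some y)); case: (c None).
clearbody B; clear cP.
(* An exchange of [G] with the empty set removes [x] and at most one further element. *)
have shrink G x : G \in feasible M -> x \in G ->
    exists H, [/\ H \in feasible M, H \subset G :\ x & #|G| <= #|H|.+2].
  move=> GM xG; have [|xM|[y [yG yx yM]]] := exchange dM GM M0 (x := x).
  - by rewrite symdiff0.
  - exists (G :+: [set x]); split=> //.
      apply/subsetP=> z; rewrite in_symdiff !inE; case: eqP => [->|]; by rewrite ?xG ?addbF.
    by have := card_symdiff1 G x; rewrite xG /=; lia.
  - exists (G :+: [set x] :+: [set y]); rewrite symdiff0 in yG; split=> //.
      apply/subsetP=> z; rewrite !in_symdiff !inE.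
      case: (eqVneq z x) => [->|_]; first by rewrite xG eq_sym (negPf yx).
      by rewrite addbF; case: eqP => [->|_]; rewrite ?yG ?addbF.
    have := card_symdiff1 G x; have := card_symdiff1 (G :+: [set x]) y.
    by rewrite xG in_symdiff yG inE (negPf yx) /=; lia.
(* The exchange in the other direction finds a loop at [x] or an edge from [x] inside [G]. *)
have grow G x : G \in feasible M -> x \in G ->
    [set x] \in feasible M \/ exists y, [/\ y \in G, y != x & [set x] :+: [set y] \in feasible M].
  move=> GM xG; have := exchange dM M0 GM (x := x).
  by rewrite !symdiff0l => /(_ xG).
have balanced n G : #|G| <= n -> G \in feasible M -> #|G :&: B| <= #|G :\: B| <= #|G :&: B|.+1.
  elim: n G => [|n IHn] G.
    by rewrite leqn0 cards_eq0 => /eqP-> _; rewrite set0I set0D cards0.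
  move=> leG GM.
  have cardG := cardsID B G.
  have sub (H : {set T}) x : H \subset G :\ x -> x \in G ->
      [/\ #|H| <= n, #|H :&: B| + (x \in B) <= #|G :&: B|
      & #|H :\: B| + (x \notin B) <= #|G :\: B|].
    move=> sH xG; split.
    - have := subset_leq_card sH; rewrite (cardsD1 x G) xG in leG; lia.
    - rewrite (cardsD1 x (G :&: B)) inE xG /= addnC leq_add2l.
      apply/subset_leq_card/subsetP=> z.
      by rewrite !inE => /andP[/(subsetP sH)]; rewrite !inE => /andP[-> ->] ->.
    - rewrite (cardsD1 x (G :\: B)) inE xG andbT addnC leq_add2l.
      apply/subset_leq_card/subsetP=> z.
      by rewrite !inE => /andP[-> /(subsetP sH)]; rewrite !inE => /andP[-> ->].
  apply/andP; split.
    (* Shrinking at some [x] outside [B] removes at most one element of [B], so the inequality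
       passes from [H] to [G]. If [G] lies in [B], [grow] is contradictory at each of its elements
       and [G] is empty. *)
    have [GB0|/set0Pn[x]] := eqVneq (G :\: B) set0; last first.
      case/setDP=> xG xB; have [H [HM sH cH]] := shrink G x GM xG.
      have [Hn] := sub _ _ sH xG; rewrite xB (negPf xB) /= => le1 le2.
      have /andP[] := IHn _ Hn HM; have := cardsID B H; lia.
    have sGB : G \subset B by rewrite -setD_eq0 GB0.
    have [->|/set0Pn[x xG]] := eqVneq G set0; first by rewrite set0I cards0.
    case: (grow G x GM xG) => [/loopN|[y [yG yx /(edgeN _ _)]]].
      by rewrite (subsetP sGB).
    by rewrite eq_sym yx !(subsetP sGB) // => /(_ isT).
  have [GB0|/set0Pn[x]] := eqVneq (G :&: B) set0; last first.
    case/setIP=> xG xB; have [H [HM sH cH]] := shrink G x GM xG.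
    have [Hn] := sub _ _ sH xG; rewrite xB /= => le1 le2.
    have /andP[] := IHn _ Hn HM; have := cardsID B H; lia.
  have nB x : x \in G -> x \notin B.
    by move=> xG; apply/negP=> xB; have := in_set0 x; rewrite -GB0 inE xG xB.
  have loops x : x \in G -> [set x] \in feasible M.
    move=> xG; case: (grow G x GM xG) => [//|[y [yG yx /(edgeN _ _)]]].
    by rewrite eq_sym yx (negPf (nB _ xG)) (negPf (nB _ yG)) => /(_ isT).
  rewrite GB0 cards0; rewrite GB0 cards0 add0n in cardG; rewrite cardG.
  (* All elements of [G] are now loops outside [B]. Induction gives [H] at most one element, hence
     [G] at most three: two would form an edge within a colour class, three the triple excluded by
     [noD2]. *)
  rewrite leqNgt; apply/negP=> gt1.
  have [x xG] : exists x, x \in G by apply/set0Pn; rewrite -card_gt0; lia.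
  have [H [HM sH cH]] := shrink G x GM xG.
  have [Hn le1 le2] := sub _ _ sH xG.
  have HB0 : #|H :&: B| = 0 by move: le1; rewrite GB0 cards0; lia.
  have := IHn _ Hn HM; rewrite HB0 => /andP[_ leH].
  have cH' := cardsID B H.
  have : #|G| = 2 \/ #|G| = 3 by lia.
  case=> [/eqP/cards2P[p [q [pq EG]]]|cG].
    have := edgeN p q pq; rewrite -symdiff_set2 // -EG GM => /(_ isT).
    by rewrite !(negPf (nB _ _)) // EG !inE eqxx ?orbT.
  have /cards2P[q [r [qr Eqr]]] : #|G :\ x| == 2.
    by move: cG; rewrite (cardsD1 x) xG; lia.
  have EG : G = [set x] :+: [set q] :+: [set r].
    rewrite -symdiffA -symdiff_set2 // -Eqr; apply/setP=> z.
    by rewrite in_symdiff !inE; case: eqP => [->|].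
  have [qG xq] : q \in G /\ x != q.
    have : q \in G :\ x by rewrite Eqr !inE eqxx.
    by rewrite !inE eq_sym => /andP[].
  have [rG xr] : r \in G /\ x != r.
    have : r \in G :\ x by rewrite Eqr !inE eqxx orbT.
    by rewrite !inE eq_sym => /andP[].
  have := noD2 x q r; rewrite -EG GM !loops // /= !inE (negPf xq) (negPf xr) qr.
  by move=> /(_ isT isT isT isT).
(* The size of [B :+: F] is that of [B], minus [#|F :&: B|], plus [#|F :\: B|]. *)
exists B, #|B| => F FM; have := balanced _ F (leqnn _) FM.
rewrite card_symdiff_split; have := cardsID F B; rewrite setIC; lia.
Qed.

Lemma coloring_thin M X (c : option T -> bool) : is_delta_matroid M ->
  X \in feasible M -> (forall u v, adj M X u v -> c u != c v) ->
  (forall p q r, uniq [:: p; q; r] -> X :+: [set p] \in feasible M ->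
     X :+: [set q] \in feasible M -> X :+: [set r] \in feasible M ->
     X :+: [set p] :+: [set q] :+: [set r] \notin feasible M) ->
  thin M.
Proof.
move=> dM XM cP noD2; apply: (@thin_twist _ X); apply: (coloring_thin0 (c := c)).
- by apply: twist_delta_matroid => //; case: dM => sM _ _; apply: sM.
- by rewrite in_twist symdiff0.
- by move=> u v; rewrite adj_twist; apply: cP.
- by move=> p q r upqr; rewrite !in_twist !symdiffA; apply: noD2.
Qed.

(* The minor of M whose feasible sets are those agreeing with X outside Y. *)
Definition restr M X (Y : {set T}) : set_system T :=
  SetSystem Y [set S : {set T} | (S \subset Y) && ((X :\: Y) :|: S \in feasible M)].

(** Elements outside [Y] are removed one at a time: contracted if in [X], deleted otherwise. As [X]
    is feasible, the former are no loops and the latter no coloops. *)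
Lemma restr_minor D M X Y : is_delta_matroid M -> minor D M -> X \in feasible M ->
  Y \subset ground M -> minor D (restr M X Y).
Proof.
have [n] := ubnP #|ground M :\: Y|; elim: n M X => // n IHn M X leM dM DM XM sY.
have sM F : F \in feasible M -> F \subset ground M by case: dM => s _ _; apply: s.
have [EY|] := eqVneq (ground M) Y.
  rewrite (_ : restr M X Y = M) //; apply: set_system_eq => //=.
  apply/setP=> F; rewrite inE -EY (_ : X :\: _ = set0) ?set0U; last first.
    by apply/eqP; rewrite setD_eq0 sM.
  by apply/andP/idP => [[]|FM] //; rewrite sM.
rewrite eqEsubset sY andbT => /subsetPn[x xM xY].
have [M1 [gM1 fM1 DM1 dM1]] : exists M1 : set_system T, [/\ ground M1 = ground M :\ x,
    forall F, (F \in feasible M1) = (x \notin F) &&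
      ((if x \in X then x |: F else F) \in feasible M), minor D M1 & is_delta_matroid M1].
  case xX: (x \in X).
    have mM := minor_contraction (minor_refl M) xM.
    exists (contraction M x); split; [| |exact: minor_contraction|exact: minor_delta_matroid mM].
      by rewrite /contraction; case: ifP.
    move=> F; rewrite /contraction (_ : loop M x = false); last first.
      by apply/negbTE/forall_inPn; exists X; rewrite ?xX.
    apply/imsetP/andP=> [[G /setIdP[GM xG] ->]|[xF FM]].
      by rewrite setD1K // !inE eqxx.
    by exists (x |: F); rewrite ?setU1K // inE FM !inE eqxx.
  have mM := minor_deletion (minor_refl M) xM.
  exists (deletion M x); split; [| |exact: minor_deletion|exact: minor_delta_matroid mM].
    by rewrite /deletion; case: ifP.
  move=> F; rewrite /deletion (_ : coloop M x = false); last first.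
    by apply/negbTE/forall_inPn; exists X; rewrite ?xX.
  by rewrite inE subsetD1 andbC; case FM: (F \in feasible M); rewrite ?andbF // sM.
have XM1 : X :\ x \in feasible M1.
  rewrite fM1 !inE eqxx /=; case: ifP => xX; first by rewrite setD1K.
  by rewrite (_ : X :\ x = X) //; apply/setDidPl; rewrite disjoint_sym disjoints1 xX.
rewrite (_ : restr M X Y = restr M1 (X :\ x) Y).
  apply: IHn => //; last by rewrite gM1 subsetD1 sY.
  by move: leM; rewrite gM1 [#|_ :\: Y|](cardsD1 x) !inE xY xM /= setDDl setUC -setDDl.
apply: set_system_eq => //=; apply/setP=> S; rewrite !inE; case sS: (S \subset Y) => //=.
rewrite fM1 !inE eqxx (contraNF (subsetP sS x)) //= andbF /=; congr (_ \in feasible M).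
by apply/setP=> z; case: ifP => xX; rewrite !inE; case: (eqVneq z x) => [->|]; rewrite ?xX ?xY.
Qed.

(** [g] runs from [N] to [M], the direction in which labels are assigned to elements; the
    isomorphism is its inverse, which exists by counting. *)
Lemma isomorphic_imset (T2 : finType) (M : set_system T) (N : set_system T2) (g : T2 -> T) :
  {in ground N &, injective g} -> ground M = g @: ground N ->
  (forall S : {set T2}, S \subset ground N -> (g @: S \in feasible M) = (S \in feasible N)) ->
  isomorphic M N.
Proof.
move=> g_inj gM feas.
have gP (y : {y | y \in ground N}) : g (val y) \in ground M by rewrite gM imset_f ?(valP y).
pose h y : {x | x \in ground M} := exist _ (g (val y)) (gP y).
have h_inj : injective h.
  by move=> y z /(congr1 val) /= /g_inj; rewrite !(valP y) !(valP z) => /(_ isT isT)/val_inj.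
have [f fK hK] : bijective h.
  apply: inj_card_bij h_inj _; rewrite !card_sig gM.
  by rewrite -[leqRHS](card_in_imset g_inj); apply/eq_leq/eq_card.
exists f; first by exists h.
move=> X; rewrite -feas; last by apply/subsetP=> _ /imsetP[y _ ->]; apply: valP.
congr (_ \in feasible M); rewrite -!imset_comp; apply: eq_imset => x /=.
by rewrite -[in LHS](hK x).
Qed.

Definition has_excluded_minor D := exists (M : set_system T) (N : set_system 'I_3),
  [/\ minor D M, excluded_minor N & isomorphic M N].

(** Seen from [X], the sets in the image of [g] form the pattern [D0]. Seen from the empty set, the
    same minor is the twist of [D0] by the trace [A] of [X]. *)
Lemma has_excluded_minorP D M X (D0 : set_system 'I_3) (g : 'I_3 -> T) :
  is_delta_matroid M -> minor D M -> X \in feasible M ->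
  D0 = D1 \/ D0 = D2 \/ D0 = D3 \/ D0 = D4 \/ D0 = D5 ->
  {in ground D0 &, injective g} -> g @: ground D0 \subset ground M ->
  (forall S : {set 'I_3}, S \subset ground D0 ->
     (S \in feasible D0) = (X :+: g @: S \in feasible M)) ->
  has_excluded_minor D.
Proof.
move=> dM DM XM D0P g_inj sgM feas.
pose A := [set i in ground D0 | g i \in X].
have sA : A \subset ground D0 by apply/subsetP=> i; rewrite inE => /andP[].
exists (restr M X (g @: ground D0)), (twist D0 A); split.
- exact: restr_minor.
- by exists D0, A; split.
apply: (isomorphic_imset (g := g)) => // S sS.
have sAS : A :+: S \subset ground D0.
  by apply/subsetP=> i; rewrite in_setU => /orP[] /setDP[]; [move/(subsetP sA)|move/(subsetP sS)].
rewrite in_twist feas // inE imsetS //=; congr (_ \in feasible M); apply/setP=> x.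
rewrite in_symdiff in_setU in_setD; case: (boolP (x \in g @: ground D0)) => [/imsetP[i iD ->]|xN].
  have im (B : {set 'I_3}) : B \subset ground D0 -> (g i \in g @: B) = (i \in B).
    move=> sB; apply/imsetP/idP => [[j jB /g_inj->]|iB] //; first exact: (subsetP sB).
    by exists i.
  by rewrite !im // in_symdiff inE iD /=; case: (g i \in X); case: (i \in S).
have im (B : {set 'I_3}) : B \subset ground D0 -> (x \in g @: B) = false.
  move=> sB; apply: contraNF xN; exact: (subsetP (imsetS g sB)).
by rewrite !im // addbF orbF.
Qed.

End DeltaMatroids.

(** * The excluded minors *)

Lemma ord3P (i : 'I_3) : [\/ i = a, i = b | i = c].
Proof.
by case: i => [[|[|[|i]]] lti] //; [constructor 1|constructor 2|constructor 3]; apply: val_inj.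
Qed.

Lemma ord3_set_eq (S S' : {set 'I_3}) :
  (S == S') = [&& (a \in S) == (a \in S'), (b \in S) == (b \in S') & (c \in S) == (c \in S')].
Proof.
apply/eqP/and3P => [->|[/eqP ea /eqP eb /eqP ec]] //.
by apply/setP=> i; case: (ord3P i) => ->.
Qed.

Lemma card_ord3_set (S : {set 'I_3}) : #|S| = (a \in S) + (b \in S) + (c \in S).
Proof.
rewrite (cardsD1 a) (cardsD1 b) (cardsD1 c) !inE /= -[X in _ = X]addn0 !addnA; congr (_ + _).
by apply/eqP; rewrite cards_eq0 ord3_set_eq !inE.
Qed.

Lemma ord3_eqE : ((a == b) = false) * ((b == a) = false) * ((a == c) = false) *
  ((c == a) = false) * ((b == c) = false) * ((c == b) = false).
Proof. by []. Qed.

Ltac ord3_simpl := rewrite /= !inE ?ord3_set_eq !inE /=.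

Lemma D1_feasible (S : {set 'I_3}) : (S \in feasible D1) = (c \notin S).
Proof. by ord3_simpl; case: (a \in S); case: (b \in S); case: (c \in S). Qed.

(** Boolean tables of this form serve as the argument [tab] of [has_excluded_triple]. *)
Lemma D2_feasible (S : {set 'I_3}) : (S \in feasible D2) =
  ~~ (if a \in S then (b \in S) (+) (c \in S) else (b \in S) && (c \in S)).
Proof. by ord3_simpl; case: (a \in S); case: (b \in S); case: (c \in S). Qed.

Lemma D3_feasible (S : {set 'I_3}) : (S \in feasible D3) =
  ~~ ((a \in S) (+) (b \in S) (+) (c \in S)).
Proof. by ord3_simpl; case: (a \in S); case: (b \in S); case: (c \in S). Qed.

Lemma D4_feasible (S : {set 'I_3}) : (S \in feasible D4) =
  if a \in S then (b \in S) || (c \in S) else (b \in S) == (c \in S).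
Proof. by ord3_simpl; case: (a \in S); case: (b \in S); case: (c \in S). Qed.

Lemma D5_feasible (S : {set 'I_3}) : (S \in feasible D5) =
  if a \in S then ~~ ((b \in S) && (c \in S)) else (b \in S) == (c \in S).
Proof. by ord3_simpl; case: (a \in S); case: (b \in S); case: (c \in S). Qed.

Lemma excluded_ground (D0 : set_system 'I_3) S :
  D0 = D1 \/ D0 = D2 \/ D0 = D3 \/ D0 = D4 \/ D0 = D5 -> S \in feasible D0 -> S \subset ground D0.
Proof.
move=> D0P; have full : S \subset [set a; b; c].
  by apply/subsetP=> i _; case: (ord3P i) => ->; rewrite !inE.
case: D0P => [->|[->|[->|[->|->]]]] //; rewrite D1_feasible => cS.
by apply/subsetP=> i iS; case: (ord3P i) iS => ->; rewrite ?(negPf cS) // !inE.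
Qed.

(** A finite check over the traces of [A] on three elements and over [k]; from [k = 4] on, no set of
    three elements is large enough. *)
Lemma excluded_not_thin (D0 : set_system 'I_3) :
  D0 = D1 \/ D0 = D2 \/ D0 = D3 \/ D0 = D4 \/ D0 = D5 -> ~ thin D0.
Proof.
move=> D0P [A [k kP]].
have {}kP F : (F \in feasible D0) ==> (k <= #|A :+: F| <= k.+1) by apply/implyP/kP.
have : all (fun F : {set 'I_3} => (F \in feasible D0) ==> (k <= #|A :+: F| <= k.+1))
    [:: set0; [set a]; [set b]; [set c]; [set a; b]; [set b; c]; [set a; c]; [set a; b; c]].
  by apply/allP=> F _; apply: kP.
apply/negP; clear kP; rewrite /= !card_ord3_set !in_symdiff.
case: D0P => [->|[->|[->|[->|->]]]];
  rewrite ?(D1_feasible, D2_feasible, D3_feasible, D4_feasible, D5_feasible) !inE ?ord3_eqE ?eqxx;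
  case: (a \in A); case: (b \in A); case: (c \in A); by case: k => [|[|[|[|k]]]].
Qed.

(** * Thinness under minors and isomorphism *)

Lemma imset_symdiff (T1 T2 : finType) (g : T1 -> T2) (X Y : {set T1}) :
  injective g -> g @: (X :+: Y) = g @: X :+: g @: Y.
Proof.
move=> g_inj; apply/setP=> y; rewrite in_symdiff.
case: (boolP (y \in codom g)) => [/codomP[x ->]|yN]; first by rewrite !mem_imset // in_symdiff.
have im (Z : {set T1}) : (y \in g @: Z) = false.
  by apply: contraNF yN => /imsetP[x _ ->]; apply: codom_f.
by rewrite !im.
Qed.

Section Minors.
Variable T : finType.
Implicit Types (D M : set_system T) (X A : {set T}).

(** Common form of deletion and contraction: the sets [F] agree about [x], so forgetting [x] changes
    every distance to [A] by the same amount. *)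
Lemma thin_sub D M x : thin D ->
  (exists b : bool, forall S, S \in feasible M ->
     exists F, [/\ F \in feasible D, (x \in F) = b & S = F :\ x]) -> thin M.
Proof.
case=> A [k kP] [b sub].
(* The shift is one exactly when [A] and the sets [F] disagree at [x]. *)
exists (A :\ x), (k - (x \in A :+: (if b then [set x] else set0))).
move=> S /sub[F [/kP kF xF ->]].
have -> : A :\ x :+: F :\ x = (A :+: F) :\ x.
  by apply/setP=> z; rewrite !(in_symdiff, inE); case: eqP.
have -> : (x \in A :+: (if b then [set x] else set0)) = (x \in A :+: F).
  by rewrite !in_symdiff xF; case: (b); rewrite !inE ?eqxx.
by move: kF; rewrite (cardsD1 x (A :+: F)); case: (x \in A :+: F); rewrite /=; lia.
Qed.

Lemma thin_minor D M : is_delta_matroid D -> thin D -> minor D M -> thin M.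
Proof.
move=> dD tD; elim=> // {}M x DM tM _; apply: (thin_sub (x := x) tM).
  rewrite /deletion; case: ifP => _.
    by exists true => S /imsetP[F /setIdP[FM xF] ->]; exists F.
  exists false => S.
  rewrite inE subsetD1 => /and3P[SM _ xS]; exists S; split=> //; first exact/negbTE.
  by apply/esym/setDidPl; rewrite disjoint_sym disjoints1.
rewrite /contraction; case: ifP => _; last first.
  by exists true => S /imsetP[F /setIdP[FM xF] ->]; exists F.
exists false => S.
  rewrite inE subsetD1 => /and3P[SM _ xS]; exists S; split=> //; first exact/negbTE.
  by apply/esym/setDidPl; rewrite disjoint_sym disjoints1.
Qed.

(** Only the trace [A1] of [A] on the ground set can be transported; the rest of [A] contributes a
    constant, subtracted from [k]. *)
Lemma thin_isomorphic (T2 : finType) M (N : set_system T2) :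
  (forall F : {set T}, F \in feasible M -> F \subset ground M) ->
  (forall F : {set T2}, F \in feasible N -> F \subset ground N) ->
  isomorphic M N -> thin M -> thin N.
Proof.
move=> sM sN [f [f' fK f'K] feas] [A [k kP]].
pose A1 := [set x : {x | x \in ground M} | val x \in A].
exists (val @: (f @: A1)), (k - #|A :\: ground M|) => F FN.
pose F2 := [set y : {y | y \in ground N} | val y \in F].
have EF : F = val @: F2.
  apply/setP=> y; apply/idP/imsetP => [yF|[z]]; last by rewrite inE => zF ->.
  by exists (exist _ y (subsetP (sN _ FN) _ yF)); rewrite ?inE.
pose F1 := f' @: F2.
have EF2 : F2 = f @: F1 by rewrite -imset_comp (eq_imset (g := id)) ?imset_id.
have FM : val @: F1 \in feasible M by rewrite feas -EF2 -EF.
have -> : #|val @: (f @: A1) :+: F| = #|A1 :+: F1|.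
  rewrite EF EF2 -!imset_symdiff; [|exact: can_inj fK|exact: val_inj].
  by rewrite !card_imset //; [exact: can_inj fK|exact: val_inj].
have EA : A = (A :\: ground M) :|: val @: A1.
  apply/setP=> x; rewrite in_setU in_setD; apply/idP/orP => [xA|[/andP[]//|/imsetP[y]]].
    case xM: (x \in ground M); last by left.
    by right; apply/imsetP; exists (exist _ x xM); rewrite ?inE.
  by rewrite inE => yA ->.
have sub (Z : {set {x | x \in ground M}}) : val @: Z \subset ground M.
  by apply/subsetP=> _ /imsetP[x _ ->]; apply: valP.
have := kP _ FM.
have -> : #|A :+: val @: F1| = #|A :\: ground M| + #|A1 :+: F1|.
  rewrite -(card_imset (A1 :+: F1) val_inj) -cardsUI.
  rewrite [X in _ = _ + X](_ : _ = 0) ?addn0; last first.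
    apply/eqP; rewrite cards_eq0; apply/eqP/setP=> x; rewrite in_setI in_setD in_set0.
    have := subsetP (sub (A1 :+: F1)) x.
    by case: (x \in val @: _) => [/(_ isT)->|_]; rewrite ?andbF.
  apply: eq_card => x; rewrite imset_symdiff; last exact: val_inj.
  have := subsetP (sub F1) x; have := subsetP (sub A1) x.
  rewrite [in x \in A :+: _]EA in_setU !in_symdiff in_setU in_setD.
  case: (x \in val @: A1); case: (x \in val @: F1); case: (x \in ground M) => //=;
    by [move=> /(_ isT) | move=> _ /(_ isT) | rewrite ?orbF ?addbF].
lia.
Qed.

End Minors.

(** * Recognising an excluded minor at a feasible set *)

Lemma mem_eq (T : finType) (A : {set T}) x y : x \in A -> x = y -> y \in A.
Proof. by move=> xA <-. Qed.

Definition set_if (T : finType) (t : bool) (p : T) : {set T} := if t then [set p] else set0.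

Section Detection.
Variable T : finType.
Implicit Types (D M : set_system T) (X A : {set T}) (p q r : T).

Lemma has_excluded_triple (tab : bool -> bool -> bool -> bool) (D0 : set_system 'I_3)
    D M X p q r :
  is_delta_matroid M -> minor D M -> X \in feasible M -> uniq [:: p; q; r] ->
  p \in ground M -> q \in ground M -> r \in ground M ->
  D0 = D1 \/ D0 = D2 \/ D0 = D3 \/ D0 = D4 \/ D0 = D5 ->
  ground D0 = [set a; b; c] ->
  (forall S : {set 'I_3}, (S \in feasible D0) = tab (a \in S) (b \in S) (c \in S)) ->
  (forall x y z, (X :+: set_if x p :+: set_if y q :+: set_if z r \in feasible M) = tab x y z) ->
  has_excluded_minor D.
Proof.
move=> dM DM XM upqr pM qM rM D0P gD0 tabP feas.
pose g (i : 'I_3) := nth p [:: p; q; r] i.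
apply: (has_excluded_minorP (g := g) dM DM XM D0P).
- by move=> i j _ _ /eqP; rewrite nth_uniq // => /eqP/val_inj.
- by apply/subsetP=> _ /imsetP[i _ ->]; rewrite /g; case: (ord3P i) => ->.
move=> S _; rewrite tabP -feas; congr (_ \in feasible M).
rewrite -!symdiffA; congr (_ :+: _); apply/setP=> z; rewrite !in_symdiff.
move: upqr; rewrite /= !inE !negb_or => /andP[/andP[pq pr] /andP[qr _]].
have -> : g @: S = set_if (a \in S) p :|: set_if (b \in S) q :|: set_if (c \in S) r.
  have ES : S = set_if (a \in S) a :|: set_if (b \in S) b :|: set_if (c \in S) c.
    apply/eqP; rewrite ord3_set_eq /set_if.
    by case: (a \in S); case: (b \in S); case: (c \in S); rewrite !inE ?ord3_eqE.
  rewrite {1}ES !imsetU; rewrite /set_if.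
  by congr (_ :|: _ :|: _); case: ifP => _; rewrite ?imset0 ?imset_set1.
rewrite !in_setU /set_if.
case: ifP => _; case: ifP => _; case: ifP => _; rewrite !inE ?addbF ?orbF //.
all: case: (eqVneq z p) => [->|_]; rewrite ?(negPf pq) ?(negPf pr) //=.
all: by case: (eqVneq z q) => [->|_]; rewrite ?(negPf qr).
Qed.

Lemma has_excluded_pair D M X p q :
  is_delta_matroid M -> minor D M -> X \in feasible M -> p != q ->
  p \in ground M -> q \in ground M ->
  X :+: [set p] \in feasible M -> X :+: [set q] \in feasible M ->
  X :+: [set p] :+: [set q] \in feasible M -> has_excluded_minor D.
Proof.
move=> dM DM XM pq pM qM Xp Xq Xpq.
(* Both [b] and [c] go to [q]; injectivity is asked only on the ground set of [D1], which omits
   [c]. *)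
pose g (i : 'I_3) := if i == a then p else q.
apply: (has_excluded_minorP (g := g) (D0 := D1) dM DM XM).
- by left.
- move=> i j; rewrite /= !inE /g => /orP[] /eqP-> /orP[] /eqP-> //= /eqP.
    by rewrite (negPf pq).
  by rewrite eq_sym (negPf pq).
- by apply/subsetP=> _ /imsetP[i _ ->]; rewrite /g; case: ifP.
move=> S sS; have cS : c \notin S.
  by apply/negP=> /(subsetP sS); rewrite !inE ?ord3_eqE.
have ES : g @: S = set_if (a \in S) p :+: set_if (b \in S) q.
  have {1}-> : S = set_if (a \in S) a :|: set_if (b \in S) b.
    apply/eqP; rewrite ord3_set_eq (negPf cS) /set_if.
    by case: (a \in S); case: (b \in S); rewrite !inE ?ord3_eqE.
  rewrite imsetU /set_if.
  case: ifP => _; case: ifP => _;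
    rewrite ?imset0 ?imset_set1 ?symdiff0 ?symdiff0l ?setU0 ?set0U //.
  exact: symdiff_set2.
rewrite D1_feasible cS ES /set_if.
by case: ifP => _; case: ifP => _; rewrite ?symdiff0 ?symdiff0l ?symdiffA ?XM ?Xp ?Xq ?Xpq.
Qed.

End Detection.

(** * Minimal counterexamples *)

Section MinimalCounterexample.
Variables (T : finType) (D M : set_system T).
Hypotheses (dM : is_delta_matroid M) (DM : minor D M).
Hypotheses (noex : ~ has_excluded_minor D) (nthin : ~ thin M).
Hypothesis minimal : forall X Y : {set T}, X \in feasible M -> Y \proper ground M ->
  thin (restr M X Y).
Implicit Types (X Y : {set T}).

Let loop_ground X x : X \in feasible M -> X :+: [set x] \in feasible M -> x \in ground M.
Proof.
by move=> XM Xx; apply: (adj_ground (X := X) (v := None)); rewrite // /adj symdiff0.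
Qed.

(** Otherwise the elements of [s] form a proper subset [Y]. The restriction to [Y] is thin, so its
    graph is 2-colourable, yet it contains the odd cycle. *)
Lemma critical_spanning X s x : X \in feasible M -> cycle (adj M X) s -> odd (size s) ->
  x \in ground M -> Some x \in s.
Proof.
move=> XM cs os xM; apply/negP=> /negP xs; move: os; apply/negP.
pose Y := [set y in ground M | Some y \in s].
have YM : Y \proper ground M.
  rewrite properE; apply/andP; split; first by apply/subsetP=> y; rewrite inE => /andP[].
  by apply/subsetPn; exists x; rewrite // inE xM.
have in_restr (S : {set T}) : S \subset Y ->
    X :\: Y :|: S \in feasible M -> S \in feasible (restr M X Y).
  by move=> sS XS; rewrite inE sS.
have XY : X :&: Y \in feasible (restr M X Y).
  by apply: in_restr; rewrite ?subsetIr // setUC setID.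
have [c cP] := thin_coloring (minimal XM YM) XY.
apply: (cycle_even (c := c) (e := adj M X) _ cs).
have sY u : u \in s -> singleton_of u \subset Y.
  case: u => [y|] ys; last exact: sub0set.
  rewrite sub1set inE ys andbT.
  exact: (adj_ground dM XM (next_cycle cs ys)).
move=> u v us vs /andP[uv uvM]; apply: cP; rewrite /adj uv.
have su := subsetP (sY u us); have sv := subsetP (sY v vs).
apply: in_restr.
  apply/subsetP=> y; rewrite !in_symdiff in_setI; have := su y; have := sv y.
  by case: (y \in Y) => [//|/contraFF-> // /contraFF-> //]; rewrite andbF.
apply: mem_eq uvM _; apply/setP=> y; rewrite in_setU in_setD !in_symdiff in_setI.
have := su y; have := sv y.
by case: (y \in Y) => [_ _|/contraFF-> // /contraFF-> //]; rewrite ?andbT ?andbF ?addbF ?orbF.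
Qed.

(** A 2-colouring would make [M] thin unless three loops have a feasible sum. Loops share a colour
    and hence are pairwise non-adjacent, so such a triple is exactly [D2]. *)
Lemma critical_cycle X : X \in feasible M -> exists s, min_odd_cycle (adj M X) s.
Proof.
move=> XM; case: (odd_cycle_or_coloring (@adj_sym T M X)) => [[s cs os]|[c cP]].
  exact: exists_min_odd_cycle cs os.
case: nthin; apply: (coloring_thin dM XM cP) => p q r upqr Xp Xq Xr; apply/negP=> Xpqr.
have neq x y : x != y -> X :+: [set x] :+: [set y] \in feasible M -> c (Some x) != c (Some y).
  by move=> xy xyM; apply: cP; rewrite /adj xyM andbT.
have loop x : X :+: [set x] \in feasible M -> c (Some x) = ~~ c None.
  move=> xM; have : c (Some x) != c None by apply: cP; rewrite /adj symdiff0.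
  by case: (c (Some x)); case: (c None).
have edge x y : x != y -> X :+: [set x] \in feasible M -> X :+: [set y] \in feasible M ->
    (X :+: [set x] :+: [set y] \in feasible M) = false.
  by move=> xy /loop lx /loop ly; apply/negP=> /(neq _ _ xy); rewrite lx ly eqxx.
apply: noex.
apply: (has_excluded_triple (tab := fun x y z => ~~ (if x then y (+) z else y && z))
  (D0 := D2) dM DM XM upqr) => //.
- exact: loop_ground Xp.
- exact: loop_ground Xq.
- exact: loop_ground Xr.
- by right; left.
- exact: D2_feasible.
move: upqr; rewrite /= !inE !negb_or => /andP[/andP[pq pr] /andP[qr _]].
by case; case; case; rewrite /= ?symdiff0 ?XM ?Xp ?Xq ?Xr ?Xpqr // edge.
Qed.

(** All four elements lie on a shortest odd cycle, which is induced and so contains no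
    quadrangle. *)
Lemma critical_quadrangle X w x y z : X \in feasible M -> uniq [:: w; x; y; z] ->
  adj M X (Some w) (Some x) -> adj M X (Some x) (Some y) -> adj M X (Some y) (Some z) ->
  ~~ adj M X (Some z) (Some w).
Proof.
move=> XM un wx xy yz; have [s ms] := critical_cycle XM; have [cs os _] := ms.
apply: (min_odd_cycle_quadrangle (@adj_sym T M X) (@adj_irr T M X) ms _ _ wx xy yz).
  move=> _ /(mapP (s := [:: w; x; y; z]))[t tw ->]; apply: critical_spanning cs os _ => //.
  move: tw; rewrite !inE => /or4P[] /eqP->.
  - exact: adj_ground wx.
  - exact: adj_ground xy.
  - exact: adj_ground yz.
  - by rewrite adj_sym in yz; apply: adj_ground yz.
by rewrite -[X in uniq X]/(map Some [:: w; x; y; z]) map_inj_uniq //; apply: Some_inj.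
Qed.

Lemma critical_path X p0 p1 p2 p3 : X \in feasible M -> uniq [:: p0; p1; p2; p3] ->
  adj M X (Some p0) (Some p1) -> adj M X (Some p1) (Some p2) -> adj M X (Some p2) (Some p3) ->
  ~~ adj M X (Some p0) (Some p2) -> ~~ adj M X (Some p1) (Some p3) ->
  ~~ adj M X (Some p0) (Some p3) -> ~~ adj M X (Some p0) None -> adj M X (Some p3) None.
Proof.
move=> XM un /andP[_ e01] /andP[_ e12] /andP[_ e23].
move: (un); rewrite /= !inE !negb_or -!andbA => /and5P[p01 p02 p03 p12 /and3P[p13 p23 _]].
rewrite !adj_edge !adj_loop p02 p13 p03 /= => e02 e13 e03 l0.
(* At [X + {p1, p2}] the consecutive pairs of p0, p2, p1, p3 are edges; this set would close a
   quadrangle. *)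
have e0123 : X :+: [set p0] :+: [set p1] :+: [set p2] :+: [set p3] \notin feasible M.
  have := @critical_quadrangle _ p0 p2 p1 p3 e12; rewrite !adj_edge /= !inE !negb_or.
  rewrite p02 p01 p03 (eq_sym p2 p1) p12 p23 p13 (eq_sym p3 p0) p03 /= => /(_ isT).
  have E1 : X :+: [set p1] :+: [set p2] :+: [set p0] :+: [set p2] \in feasible M.
    apply: mem_eq e01 _; symdiff_tac.
  have E2 : X :+: [set p1] :+: [set p2] :+: [set p2] :+: [set p1] \in feasible M.
    apply: mem_eq XM _; symdiff_tac.
  have E3 : X :+: [set p1] :+: [set p2] :+: [set p1] :+: [set p3] \in feasible M.
    apply: mem_eq e23 _; symdiff_tac.
  move=> /(_ E1 E2 E3); apply: contraNN => h; apply: mem_eq h _; symdiff_tac.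
(* Exchange between the edges p0p1 and p2p3 at [p3]; the path being induced, together with [e0123],
   rules out every partner for [p3]. *)
have e013 : X :+: [set p0] :+: [set p1] :+: [set p3] \in feasible M.
  have [|//|[y [yF y3 yM]]] := exchange dM e01 e23 (x := p3).
    rewrite !in_symdiff !inE eqxx (eq_sym p3 p0) (negPf p03) (eq_sym p3 p1) (negPf p13).
    by rewrite (eq_sym p3 p2) (negPf p23); case: (p3 \in X).
  have : y \in [:: p0; p1; p2].
    move: yF; rewrite !in_symdiff !inE (negPf y3).
    by case: (y \in X); case: (y == p0); case: (y == p1); case: (y == p2).
  rewrite !inE => /or3P[] /eqP Ey; rewrite Ey in yM.
  - case/negP: e13; apply: mem_eq yM _; symdiff_tac.
  - case/negP: e03; apply: mem_eq yM _; symdiff_tac.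
  - case/negP: e0123; apply: mem_eq yM _; symdiff_tac.
(* Exchange back towards [X] at [p1] leaves the pair p0p3, excluded, or a loop at [p3] or [p0]. *)
have [|h|[y [yF y1 yM]]] := exchange dM e013 XM (x := p1).
- by rewrite !in_symdiff !inE eqxx (eq_sym p1 p0) (negPf p01) (negPf p13); case: (p1 \in X).
- case/negP: e03; apply: mem_eq h _; symdiff_tac.
have : y \in [:: p0; p3].
  move: yF; rewrite !in_symdiff !inE (negPf y1).
  by case: (y \in X); case: (y == p0); case: (y == p3).
rewrite !inE => /orP[] /eqP Ey; rewrite Ey in yM.
- apply: mem_eq yM _; symdiff_tac.
- case/negP: l0; apply: mem_eq yM _; symdiff_tac.
Qed.

(** An edge between two loops is [D1]. *)
Lemma critical_loops X p q : X \in feasible M -> adj M X (Some p) (Some q) ->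
  adj M X (Some p) None -> ~~ adj M X (Some q) None.
Proof.
move=> XM; rewrite adj_edge !adj_loop => /andP[pq Xpq] Xp; apply/negP=> Xq.
by apply: noex; apply: (has_excluded_pair dM DM XM pq) => //; apply: loop_ground XM _.
Qed.

Lemma critical_triangle X p q r : X \in feasible M ->
  adj M X (Some p) (Some q) -> adj M X (Some q) (Some r) -> adj M X (Some r) (Some p) -> False.
Proof.
move=> XM.
(* By [critical_loops] at most one vertex of the triangle is a loop; call it [p]. *)
wlog : p q r / ~~ adj M X (Some q) None && ~~ adj M X (Some r) None.
  move=> IH pq qr rp; case Lq: (adj M X (Some q) None).
    apply: (IH q r p) => //; rewrite (critical_loops XM qr Lq).
    by apply: critical_loops XM _ Lq; rewrite adj_sym.
  case Lr: (adj M X (Some r) None); last by apply: (IH p q r); rewrite ?Lq ?Lr.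
  by apply: (IH r p q) => //; rewrite Lq (critical_loops XM rp Lr).
rewrite !adj_loop => /andP[/negPf Xq /negPf Xr] epq eqr erp.
have pM := adj_ground dM XM epq; have qM := adj_ground dM XM eqr; have rM := adj_ground dM XM erp.
move: epq eqr erp; rewrite !adj_edge => /andP[pq Xpq] /andP[qr Xqr] /andP[rp].
rewrite symdiffAC => Xpr; apply: noex.
have upqr : uniq [:: p; q; r] by rewrite /= !inE negb_or pq eq_sym rp qr.
(* The cases give, in turn, [D1] on q and r at [X + p], then [D5], [D4] and [D3] at [X]. *)
case Xp: (X :+: [set p] \in feasible M);
  case Xpqr: (X :+: [set p] :+: [set q] :+: [set r] \in feasible M).
- by apply: (has_excluded_pair dM DM Xp qr).
- apply: (has_excluded_triple (tab := fun x y z => if x then ~~ (y && z) else y == z)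
    (D0 := D5) dM DM XM upqr) => //; [by do 4!right|exact: D5_feasible|].
  by case; case; case; rewrite /= ?symdiff0 ?XM ?Xp ?Xq ?Xr ?Xpq ?Xpr ?Xqr ?Xpqr.
- apply: (has_excluded_triple (tab := fun x y z => if x then y || z else y == z)
    (D0 := D4) dM DM XM upqr) => //; [by do 3!right; left|exact: D4_feasible|].
  by case; case; case; rewrite /= ?symdiff0 ?XM ?Xp ?Xq ?Xr ?Xpq ?Xpr ?Xqr ?Xpqr.
- apply: (has_excluded_triple (tab := fun x y z => ~~ (x (+) y (+) z))
    (D0 := D3) dM DM XM upqr) => //; [by do 2!right; left|exact: D3_feasible|].
  by case; case; case; rewrite /= ?symdiff0 ?XM ?Xp ?Xq ?Xr ?Xpq ?Xpr ?Xqr ?Xpqr.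
Qed.

(** At [X + p0], neither [None] nor [p0] is adjacent to [p2], but [p2] has two neighbours on a
    shortest odd cycle; only [p1] and [p3] remain. *)
Lemma critical_short_path_end X p0 p1 p2 p3 : X \in feasible M -> p2 \in ground M ->
  uniq [:: p0; p1; p2; p3] -> (forall x, x \in ground M -> x \in [:: p0; p1; p2; p3]) ->
  adj M X (Some p0) None -> ~~ adj M X (Some p2) None -> ~~ adj M X (Some p0) (Some p2) ->
  adj M (X :+: [set p0]) (Some p2) (Some p1) /\ adj M (X :+: [set p0]) (Some p2) (Some p3).
Proof.
move=> XM p2M; rewrite /= !inE !negb_or -!andbA => /and5P[_ p02 _ _ _] span.
rewrite adj_edge !adj_loop p02 /= => Xp0 Xp2 Xp02.
have [s ms] := critical_cycle Xp0; have [cs os _] := ms.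
have p2s := critical_spanning Xp0 cs os p2M.
have [u [v [uv p2u p2v]]] := min_odd_cycle_degree (@adj_sym T M _) (@adj_irr T M _) ms p2s.
have nbr w : adj M (X :+: [set p0]) (Some p2) w -> w = Some p1 \/ w = Some p3.
  case: w => [w|] e2w; last by rewrite adj_loop (negPf Xp02) in e2w.
  have : w \in ground M by rewrite adj_sym in e2w; apply: adj_ground e2w.
  move/span; rewrite !inE => /or4P[] /eqP Ew; rewrite Ew in e2w *; [|by left| |by right].
    case/negP: Xp2; case/andP: e2w => _ e2w; apply: mem_eq e2w _; symdiff_tac.
  by rewrite adj_irr in e2w.
by case: (nbr _ p2u) (nbr _ p2v) => Eu [] Ev; rewrite Eu Ev ?eqxx // in uv p2u p2v *.
Qed.

(* At X + p0 the neighbours of p2 are p1 and p3, and at X + p3 those of p1 are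
   p0 and p2.  Hence p1, p2, p3 form a triangle at X + p0, and it misses p0. *)
Lemma critical_short_path X p0 p1 p2 p3 : X \in feasible M -> uniq [:: p0; p1; p2; p3] ->
  (forall x, x \in ground M -> x \in [:: p0; p1; p2; p3]) ->
  adj M X (Some p1) (Some p2) -> adj M X (Some p0) None -> adj M X (Some p3) None ->
  ~~ adj M X (Some p1) None -> ~~ adj M X (Some p2) None ->
  ~~ adj M X (Some p0) (Some p2) -> ~~ adj M X (Some p1) (Some p3) -> False.
Proof.
move=> XM un span e12 l0 l3 nl1 nl2 e02 e13.
have p1M := adj_ground dM XM e12.
have p2M : p2 \in ground M by rewrite adj_sym in e12; apply: adj_ground e12.
have [e21 e23] := critical_short_path_end XM p2M un span l0 nl2 e02.
have [|x /span||_] := critical_short_path_end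
  (p0 := p3) (p1 := p2) (p2 := p1) (p3 := p0) XM p1M _ _ l3 nl1.
- by rewrite -rev_uniq in un.
- by rewrite !inE => /or4P[] ->; rewrite ?orbT.
- by rewrite adj_sym.
move: (un); rewrite /= !inE !negb_or -!andbA => /and5P[p01 p02 p03 _ /and3P[p13 _ _]].
rewrite adj_edge => /andP[_ e310].
have Xp0 : X :+: [set p0] \in feasible M by rewrite -adj_loop.
(* The edge p1p0 at [X + p3] and the edge p3p1 at [X + p0] are the same feasible set. *)
have e31 : adj M (X :+: [set p0]) (Some p3) (Some p1).
  rewrite adj_edge eq_sym p13; apply: mem_eq e310 _; symdiff_tac.
have := @critical_spanning _ [:: Some p1; Some p2; Some p3] p0 Xp0.
rewrite /= adj_sym e21 e23 e31 !inE => /(_ isT isT (loop_ground XM Xp0)).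
by case/or3P=> /eqP[E]; rewrite E eqxx in p01 p02 p03.
Qed.

(** From length five on, the induced paths p0p1p2p3 and p1p2p3p4 each have a loop at an end. Two
    such loops give an odd cycle through [None] that misses an element. *)
Lemma critical_no_loop_cycle X t : X \in feasible M ->
  min_odd_cycle (adj M X) (map Some t) -> False.
Proof.
move=> XM ms; have [cs os _] := ms.
have span p : Some p \in map Some t -> p \in ground M.
  by move=> ps; apply: (adj_ground dM XM (next_cycle cs ps)).
have un := min_odd_cycle_uniq ms; rewrite map_inj_uniq in un; last exact: Some_inj.
have chord i j := @min_odd_cycle_nth _ _ _ None i j (@adj_sym T M X) (@adj_irr T M X) ms.
rewrite size_map in chord os.
case: t => [|p0 [|p1 [|p2 [|p3 [|p4 t]]]]] // in ms cs os span un chord *.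
- by move: cs; rewrite /= adj_irr.
- by move: cs => /= /and4P[e01 e12 e20 _]; apply: critical_triangle e01 e12 e20.
pose s := map Some [:: p0, p1, p2, p3, p4 & t].
have nc i j : i < (size t).+4.+1 -> j < (size t).+4.+1 ->
    ~~ cyclic_neighbors (size t).+4.+1 i j -> ~~ adj M X (nth None s i) (nth None s j).
  by move=> lti ltj; apply: contraNN => /chord; apply.
have miss s' x : x \in [:: p0, p1, p2, p3, p4 & t] ->
    cycle (adj M X) s' -> odd (size s') -> Some x \notin s' -> False.
  move=> xt cs' os' /negP[]; apply: critical_spanning XM cs' os' (span _ _).
  by rewrite map_f.
have un4 : uniq [:: p0; p1; p2; p3] by have := take_uniq 4 un; rewrite /= ?take0.
have un4' : uniq [:: p1; p2; p3; p4].
  by have := take_uniq 4 (drop_uniq 1 un); rewrite /= ?drop0 ?take0.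
move: (cs) => /= /and5P[e01 e12 e23 e34 cs4].
have l03 : adj M X (Some p0) None || adj M X (Some p3) None.
  case l0: (adj M X _ _) => //=; apply: (critical_path XM un4 e01 e12 e23); rewrite ?l0 //.
  - exact: (nc 0 2).
  - exact: (nc 1 3).
  - exact: (nc 0 3).
have l14 : adj M X (Some p1) None || adj M X (Some p4) None.
  case l1: (adj M X _ _) => //=; apply: (critical_path XM un4' e12 e23 e34); rewrite ?l1 //.
  - exact: (nc 1 3).
  - by apply: (nc 2 4) => //; rewrite /cyclic_neighbors /cyclic_succ; case: ifP.
  - by apply: (nc 1 4) => //; rewrite /cyclic_neighbors /cyclic_succ; case: ifP.
move: (un); rewrite /= !inE !negb_or -!andbA.
case/and5P=> n01 n02 n03 n04 /and5P[p0t n12 n13 n14 /and5P[p1t n23 n24 p2t _]].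
have inS x : (Some x \in map Some t) = (x \in t) by rewrite mem_map //; apply: Some_inj.
have SE (x y : T) : (Some x == Some y) = (x == y) by [].
(* Loops at neighbouring ends close a triangle with [None]. Otherwise [None] replaces [p1, p2, p3],
   or is inserted between [p1] and [p3] in place of [p2]; parity follows from that of the original
   cycle. *)
case/orP: l03 => [l0|l3]; case/orP: l14 => [l1|l4].
- apply: (miss [:: None; Some p0; Some p1] p2) => //=; first by rewrite !inE eqxx !orbT.
    by rewrite adj_sym l0 e01 l1.
  by rewrite !inE !SE (eq_sym p2 p0) (eq_sym p2 p1) (negPf n02) (negPf n12).
- apply: (miss [:: None, Some p4 & rcons (map Some t) (Some p0)] p1) => /=.
  + by rewrite !inE eqxx !orbT.
  + by rewrite rcons_path last_rcons adj_sym l4 cs4 l0.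
  + by rewrite size_rcons size_map; move: os => /=; rewrite !negbK.
  by rewrite !inE mem_rcons inE !SE inS (eq_sym p1 p0) (negPf n01) (negPf n14) (negPf p1t).
- pose s' := rcons (rcons (map Some t) (Some p0)) (Some p1).
  apply: (miss [:: None, Some p3, Some p4 & s'] p2); rewrite /s' /=.
  + by rewrite !inE eqxx !orbT.
  + by rewrite !rcons_path !last_rcons -rcons_path adj_sym l3 e34 cs4 e01 l1.
  + by rewrite !size_rcons size_map; move: os => /=; rewrite !negbK.
  by rewrite !inE !mem_rcons !inE mem_rcons inE !SE inS (eq_sym p2 p0) (eq_sym p2 p1)
       (negPf n02) (negPf n12) (negPf n23) (negPf n24) (negPf p2t).
- apply: (miss [:: None; Some p3; Some p4] p2) => //=; first by rewrite !inE eqxx !orbT.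
    by rewrite adj_sym l3 e34 l4.
  by rewrite !inE !SE (negPf n23) (negPf n24).
Qed.

(** By length: three gives two adjacent loops, five is the short path, and from seven on the path
    p1p2p3p4 is induced with neither end a loop. *)
Lemma critical_loop_cycle X t : X \in feasible M ->
  min_odd_cycle (adj M X) (None :: map Some t) -> False.
Proof.
move=> XM ms; have [cs os _] := ms.
have un : uniq t.
  by have := min_odd_cycle_uniq ms; rewrite /= map_inj_uniq; [case/andP|apply: Some_inj].
have chord i j : i < (size t).+1 -> j < (size t).+1 -> ~~ cyclic_neighbors (size t).+1 i j ->
    ~~ adj M X (nth None (None :: map Some t) i) (nth None (None :: map Some t) j).
  have := @min_odd_cycle_nth _ _ _ None i j (@adj_sym T M X) (@adj_irr T M X) ms.
  by rewrite /= size_map => H lti ltj; apply: contraNN; apply: H.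
have span p : p \in ground M -> p \in t.
  move=> pM; have := critical_spanning XM cs os pM.
  by rewrite inE /= mem_map //; apply: Some_inj.
rewrite /= size_map in os.
case: t => [|p0 [|p1 [|p2 [|p3 t]]]] // in ms cs os un chord span *.
  move: cs => /= /and4P[l0 e01 l1 _]; rewrite adj_sym in l0.
  by move: l1; apply/negP; apply: critical_loops XM e01 l0.
move: (cs) => /= /and5P[l0 e01 e12 e23 cs3]; rewrite adj_sym in l0.
case: t => [|p4 [|p5 t]] // in ms cs os un chord span cs3 *.
  move: cs3 => /= /andP[l3 _].
  (* Position 0 of the cycle is [None], so [p0] has position 1, and so on. *)
  apply: (critical_short_path XM un span e12 l0 l3); rewrite 1?[adj _ _ _ None]adj_sym.
  - exact: (chord 0 2).
  - exact: (chord 0 3).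
  - exact: (chord 1 3).
  - exact: (chord 2 4).
have un4 : uniq [:: p1; p2; p3; p4] by have := take_uniq 4 (drop_uniq 1 un); rewrite /= ?take0.
move: cs3 => /= /andP[e34 _].
suff: adj M X (Some p4) None by apply/negP; rewrite adj_sym; apply: (chord 0 5).
apply: (critical_path XM un4 e12 e23 e34); rewrite 1?[adj _ _ _ None]adj_sym.
- exact: (chord 2 4).
- exact: (chord 3 5).
- exact: (chord 2 5).
- exact: (chord 0 2).
Qed.

Lemma no_critical : False.
Proof.
have [sM /set0Pn[X XM] _] := dM; have [s ms] := critical_cycle XM.
have noNone (s' : seq (option T)) : None \notin s' -> s' = map Some (pmap id s').
  by elim: s' => //= -[x|] s' IHs; rewrite inE //= => /IHs {1}->.
case: (boolP (None \in s)) => [Ns|/noNone Es]; last first.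
  by rewrite Es in ms; apply: critical_no_loop_cycle ms.
have [n s' Es'] := rot_to Ns; have := min_odd_cycle_rot n ms; rewrite Es' => {}ms.
have := min_odd_cycle_uniq ms; rewrite /= => /andP[/noNone Es _].
by rewrite Es in ms; apply: critical_loop_cycle ms.
Qed.

End MinimalCounterexample.

(** * Both directions of the characterisation *)

(** Induction on the size of the ground set over all minors [M] of [D]; the induction hypothesis
    makes a non-thin [M] a minimal counterexample. *)
Lemma thin_of_no_excluded_minor (T : finType) (D : set_system T) :
  is_delta_matroid D -> ~ has_excluded_minor D -> thin D.
Proof.
move=> dD noex.
suff: forall n M, #|ground M| < n -> is_delta_matroid M -> minor D M -> thin M.
  by apply; [exact: leqnn|exact: dD|exact: minor_refl].
elim=> // n IHn M; rewrite ltnS => leM dM DM.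
(* Via [thin_width], thinness becomes a Boolean, which allows the case distinction. *)
pose thinb := [exists A : {set T}, (A \subset ground M) && (width (twist M A) <= 1)].
case: (boolP thinb) => [/existsP[A /andP[sA wA]]|/existsPn nthin].
  by apply/thin_width=> //; exists A.
have {}nthin : ~ thin M.
  by move/(thin_width dM)=> [A sA wA]; have := nthin A; rewrite sA wA.
case: (no_critical dM DM noex nthin) => X Y XM YM.
have RM := restr_minor dM DM XM (proper_sub YM).
apply: (IHn _ _ _ RM); last exact: minor_delta_matroid dD RM.
exact: leq_trans (proper_card YM) leM.
Qed.

Theorem theorem1p3 (T : finType) (D : set_system T) (hD : is_delta_matroid D) :
  (exists2 A : {set T}, A \subset ground D & width (twist D A) <= 1)
  <->
  ~ (exists (M : set_system T) (N : set_system 'I_3),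
       [/\ minor D M, excluded_minor N & isomorphic M N]).
Proof.
rewrite -(thin_width hD); split; last exact: thin_of_no_excluded_minor.
(* Thinness passes from [D] to [M], then to [N] and, undoing the twist, to [D0], which is not
   thin. *)
move=> tD [M [N [DM [D0 [A [D0P sA ->]]] MN]]].
have [sM _ _] := minor_delta_matroid hD DM.
apply: (excluded_not_thin D0P); apply: (@thin_twist _ _ A).
apply: thin_isomorphic MN (thin_minor hD tD DM) => // F /imsetP[G GD0 ->] /=.
apply/subsetP=> x; rewrite in_setU => /orP[] /setDP[]; first by move/(subsetP sA).
by move/(subsetP (excluded_ground D0P GD0)).
Qed.
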